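(* Let $k$ be an algebraically closed field of arbitrary characteristic, let $G$ have type $A_1$ (realized as $G=SL_2(k)$), let $B$ be a Borel subgroup of $G$ (realized as the upper triangular matrices in $G$), and let $\mathfrak{n}$ be the nilradical of the Lie algebra $\mathfrak{b}$ of $B$, i.e. the strictly upper triangular $2\times 2$ matrices, on which $B$ acts by conjugation. Let $x_\alpha=e_{12}$ and let $X$ be the coordinate function on $\mathfrak{n}$ with $X(zx_\alpha)=z$. Then $B$ has exactly two orbits on $\mathfrak{n}$ (in particular $B$ has modality $0$), namely: (1) $B.0=Z(X)$, with closure $Z(X)$ and dimension $0$; (2) $B.x_\alpha=V(X)$, with closure $\mathfrak{n}$ and dimension $1$. The closure ordering on the set of orbits is the chain $B.0<B.x_\alpha$.
   Context: For polynomial functions on the affine space $\mathfrak{n}$: $Z(f_1,\dots,f_m)$ is the set of common zeros of $f_1,\dots,f_m$ in $\mathfrak{n}$, and $V(g_1,\dots,g_\ell)$ is the set of points of $\mathfrak{n}$ at which every one of $g_1,\dots,g_\ell$ is nonzero. The action of $B$ on $\mathfrak{n}$ is the Adjoint action, $b.x=bxb^{-1}$. Closures and dimensions are with respect to the Zariski topology. The closure ordering is $\mathcal{O}\le\mathcal{O}'$ iff $\mathcal{O}\subseteq\overline{\mathcal{O}'}$. $B$ having modality $0$ on $\mathfrak{n}$ means that the number of $B$-orbits on $\mathfrak{n}$ is finite. Since isogenous groups have the same orbits, a group of type $A_n$ is taken to be $SL_{n+1}(k)$, with $B$ the upper triangular subgroup. $e_{ij}$ is the matrix with $1$ in position $(i,j)$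 and $0$ elsewhere. *)

(* Defs.v *)
From HB Require Import structures.
From mathcomp Require Import all_boot all_order all_algebra.
From mathcomp Require Import boolp classical_sets cardinality.
From mathcomp Require Import topology.
(* The notations of mpoly clash with those of classical_sets. *)
From mathcomp Require Import -(notations) mpoly.

Set Implicit Arguments.
Unset Strict Implicit.
Unset Printing Implicit Defensive.

Import GRing.Theory.

Local Open Scope classical_set_scope.
Local Open Scope ring_scope.

Section Group.
Variables (k : closedFieldType) (n : nat).
Implicit Types A b : 'M[k]_n.

Definition upper_triangular A :=
  [forall i : 'I_n, forall j : 'I_n, (j < i)%N ==> (A i j == 0)].

Definition strict_upper : {pred 'M[k]_n} :=
  fun A => [forall i : 'I_n, forall j : 'I_n, (j <= i)%N ==> (A i j == 0)].

Lemma upper_triangularP A :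
  reflect (forall i j : 'I_n, (j < i)%N -> A i j = 0) (upper_triangular A).
Proof.
apply: (iffP forallP) => [h i j ji|h i].
  by have /forallP/(_ j)/implyP/(_ ji)/eqP := h i.
by apply/forallP => j; apply/implyP => /h ->.
Qed.

Lemma strict_upperP A :
  reflect (forall i j : 'I_n, (j <= i)%N -> A i j = 0) (A \in strict_upper).
Proof.
apply: (iffP forallP) => [h i j ji|h i].
  by have /forallP/(_ j)/implyP/(_ ji)/eqP := h i.
by apply/forallP => j; apply/implyP => /h ->.
Qed.

Lemma strict_upper_submod_closed : submod_closed strict_upper.
Proof.
split=> [|a A b /strict_upperP hA /strict_upperP hb]; apply/strict_upperP.
  by move=> i j _; rewrite mxE.
by move=> i j ji; rewrite !mxE hA// hb// mulr0 addr0.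
Qed.

HB.instance Definition _ :=
  GRing.isSubmodClosed.Build k 'M[k]_n strict_upper strict_upper_submod_closed.

(* The Lie algebra of the unipotent radical of B. When the characteristic
   divides n, the Lie algebra of B also contains the scalar matrices; they are
   not part of its nilradical in this sense. *)
Record nilrad := Nilrad { nilmx :> 'M[k]_n ; _ : nilmx \in strict_upper }.

HB.instance Definition _ := [isSub for nilmx].
HB.instance Definition _ := [Choice of nilrad by <:].
HB.instance Definition _ := [SubChoice_isSubLmodule of nilrad by <:].

Record borel := Borel {
  bmx :> 'M[k]_n ;
  bmx_det : \det bmx = 1 ;
  bmx_upper : upper_triangular bmx }.

Lemma bmx_unit (b : borel) : (b : 'M[k]_n) \in unitmx.
Proof. by rewrite unitmxE bmx_det unitr1. Qed.

Lemma bmx_diag (b : borel) i : b i i != 0.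
Proof.
apply/eqP => bii0; have : \det b^T = 1 by rewrite det_tr bmx_det.
rewrite det_trig.
  rewrite (bigD1 i)//= mxE bii0 mul0r => /esym/eqP; exact/negP/oner_neq0.
apply/is_trig_mxP => p q pq; rewrite mxE.
by have /upper_triangularP -> := bmx_upper b.
Qed.

Lemma Ad_subproof (b : borel) (x : nilrad) :
  b *m x *m invmx b \in strict_upper.
Proof.
set C := b *m x *m invmx b.
have Cb : C *m b = b *m x by rewrite /C mulmxKV// bmx_unit.
move: C Cb => C Cb.
have /upper_triangularP ub := bmx_upper b.
have /strict_upperP ux := valP x.
apply/strict_upperP => i j; case: j => j jn /=.
elim/ltn_ind: j jn => j IH jn ji.
have /matrixP/(_ i (Ordinal jn)) := Cb; rewrite !mxE.
rewrite (bigD1 (Ordinal jn))//= big1 ?addr0; last first.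
  move=> l lj; have [lt|ge] := ltnP l j.
    case: l lt {lj} => l ln /= lt.
    by rewrite (IH _ lt) ?mul0r//; exact: leq_trans (ltnW lt) ji.
  rewrite ub ?mulr0// ltn_neqAle ge andbT.
  by apply: contraNN lj => /eqP jl; apply/eqP/val_inj.
rewrite big1.
  by move=> /eqP; rewrite mulf_eq0 (negPf (bmx_diag _ _)) orbF => /eqP.
move=> l _; have [lt|ge] := ltnP l i; first by rewrite ub ?mul0r.
by rewrite ux ?mulr0//=; exact: leq_trans ji ge.
Qed.

Definition Ad (b : borel) (x : nilrad) : nilrad := Nilrad (Ad_subproof b x).

Definition B_orbit (x : nilrad) : set nilrad := range (Ad^~ x).

Definition B_orbits : set (set nilrad) := range B_orbit.

Definition modality0 : Prop := finite_set B_orbits.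

(* Restrictions of polynomials in all n * n matrix entries: the entries on and
   below the diagonal vanish on nilrad, so these are exactly the polynomials in the
   coordinates x i j with i < j. *)
Definition polynomial_fun (f : nilrad -> k) : Prop :=
  exists p : mpoly (n * n) k,
    forall x : nilrad, f x = meval (fun i => mxvec x 0 i) p.

Definition Z (fs : seq (nilrad -> k)) : set nilrad :=
  [set x | all (fun f => f x == 0) fs].

Definition V (gs : seq (nilrad -> k)) : set nilrad :=
  [set x | all (fun g => g x != 0) gs].

Definition zariski_closed (C : set nilrad) : Prop :=
  exists2 F : set (nilrad -> k), F `<=` polynomial_fun
    & C = [set x | forall f, F f -> f x = 0].

Definition zariski_open (U : set nilrad) : Prop := zariski_closed (~` U).

Lemma zariski_openT : zariski_open setT.
Proof.
exists [set fun=> 1].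
  by move=> _ ->; exists 1 => x; rewrite meval1.
by rewrite setCT; apply/esym/seteqP; split=> // x /(_ _ erefl)/eqP; rewrite oner_eq0.
Qed.

Lemma zariski_openI : setI_closed zariski_open.
Proof.
move=> U W [F polF UE] [H polH WE].
exists [set h | exists2 f, F f & exists2 g, H g & h = (fun x => f x * g x)].
  move=> _ [f /polF [p fE]] [g /polH [q gE] ->].
  by exists (p * q) => x; rewrite fE gE mevalM.
rewrite setCI UE WE; apply/seteqP; split=> x /=.
  by move=> h _ [f Ff] [g Hg ->]; case: h => h;
    rewrite ?(h _ Ff) ?(h _ Hg) ?mul0r ?mulr0.
move=> h; apply: contrapT => /not_orP[/existsNP[f /not_implyP[Ff fx]]].
move=> /existsNP[g /not_implyP[Hg gx]].
have /eqP : f x * g x = 0.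
  by apply: (h (fun x => f x * g x)); exists f => //; exists g.
by rewrite mulf_eq0 => /orP[] /eqP.
Qed.

Lemma zariski_open_bigU (I : Type) (U : I -> set nilrad) :
  (forall i, zariski_open (U i)) -> zariski_open (\bigcup_i U i).
Proof.
move=> oU.
exists [set f | polynomial_fun f /\
    exists i, forall x, (~` U i) x -> f x = 0]; first by move=> f [].
apply/seteqP; split=> x /=.
  by move=> Ux f [_ [i]]; apply => Uix; apply: Ux; exists i.
move=> h [i _ Uix]; have [F polF UE] := oU i.
have : (~` U i) x.
  rewrite UE => f Ff; apply: h; split; first exact: polF.
  exists i => y nUy; have : (~` U i) y by [].
  by rewrite UE; apply.
by apply.
Qed.

HB.instance Definition _ := @isOpenTopological.Build nilrad zariski_open
  zariski_openT zariski_openI zariski_open_bigU.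

Lemma closed_zariskiE (C : set nilrad) : closed C = zariski_closed C.
Proof. by rewrite -openC -[in RHS](setCK C). Qed.

Definition orbit_le (O O' : set nilrad) : Prop := O `<=` closure O'.

Definition orbit_lt (O O' : set nilrad) : Prop := orbit_le O O' /\ O <> O'.

End Group.

Arguments B_orbits : clear implicits.
Arguments modality0 : clear implicits.

Section Dimension.
Variable T : topologicalType.
Implicit Types S C : set T.

(* Irreducibility of S as a subspace: covering S by two closed sets of T is
   the same as covering it by two relatively closed ones. *)
Definition irreducible S : Prop :=
  S !=set0 /\ forall C D, closed C -> closed D ->
    S `<=` C `|` D -> S `<=` C \/ S `<=` D.

Definition closed_in S C : Prop := exists2 D, closed D & C = S `&` D.

(* c 0 < ... < c m is a chain of length m; later values of c are irrelevant. *)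
Definition irreducible_chain S m (c : nat -> set T) : Prop :=
  (forall i, (i <= m)%N -> closed_in S (c i) /\ irreducible (c i)) /\
  (forall i, (i < m)%N -> c i `<` c i.+1).

(* d is the Krull dimension of S in the subspace topology. *)
Definition has_dim S (d : nat) : Prop :=
  (exists c, irreducible_chain S d c) /\
  (forall m c, irreducible_chain S m c -> (m <= d)%N).

End Dimension.

Section A1.
Variable k : closedFieldType.

Lemma e12_subproof : (delta_mx 0 1 : 'M[k]_2) \in @strict_upper k 2.
Proof.
apply/strict_upperP => i j ji; rewrite mxE.
by case: andP => // -[/eqP iE /eqP jE]; move: ji; rewrite iE jE.
Qed.

Definition x_alpha : nilrad k 2 := Nilrad e12_subproof.

Definition X : nilrad k 2 -> k := fun x => x 0 1.

Lemma X_x_alpha z : X (z *: x_alpha) = z.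
Proof. by rewrite /X !mxE/= mulr1. Qed.

Lemma X_polynomial : polynomial_fun X.
Proof.
exists (mpolyX _ (mnm1 (mxvec_index 0 1))) => x.
by rewrite mevalXU mxvecE.
Qed.

End A1.

Arguments X : clear implicits.

(* Main.v *)
(** Conjugation by an upper triangular [b] multiplies the coordinate [X] by the
    square of the upper left entry of [b], and every element of [k] is a square,
    so the orbits are [X = 0] and [X <> 0].  Through [X], polynomial functions
    on [n] become one-variable polynomials, so the proper closed subsets of [n]
    are exactly the finite ones; since [k] is infinite this yields the closures,
    the irreducibility of [B.x_alpha] and the dimensions. *)

Require Import Defs.
From mathcomp Require Import all_boot all_order all_algebra.
From mathcomp Require Import boolp classical_sets cardinality topology.
From mathcomp Require Import -(notations) mpoly.

Set Implicit Arguments.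
Unset Strict Implicit.
Unset Printing Implicit Defensive.

Import GRing.Theory.

Local Open Scope classical_set_scope.
Local Open Scope ring_scope.

Lemma closed_field_infinite (k : closedFieldType) : infinite_set [set: k].
Proof.
move=> /finite_seqP[s sE].
have sT x : x \in s by have : [set: k] x by []; rewrite sE.
(* Euclid's argument: a root of [q * 'X + 1] cannot lie in [s]. *)
pose q : {poly k} := \prod_(a <- s) ('X - a%:P).
have q1 : (1 < size (q * 'X)%R)%N.
  by rewrite size_mulX ?monic_neq0 ?monic_prod_XsubC// size_prod_XsubC.
have /closed_rootP[x /rootP] : size (q * 'X + 1) != 1%N.
  by rewrite size_polyDl ?size_poly1// neq_ltn q1 orbT.
have /rootP qx : root q x by rewrite root_prod_XsubC.
by rewrite !hornerE qx mul0r add0r => /eqP; rewrite oner_eq0.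
Qed.

Lemma closed_field_sqrt (k : closedFieldType) (a : k) : exists z, z ^+ 2 = a.
Proof.
(* The chosen coefficients give the equation [z ^+ 2 = a * z ^+ 0 + 0 * z ^+ 1], solvable in every
   characteristic. *)
have [z zE] := @solve_monicpoly k 2 (fun i => if i is 0%N then a else 0) isT.
by exists z; rewrite zE !big_ord_recr big_ord0/= mul0r expr0 mulr1 add0r addr0.
Qed.

Section Irreducible.
Variable T : topologicalType.

Lemma irreducible1 (x : T) : irreducible [set x].
Proof.
split; first by exists x.
by move=> C D _ _ /(_ x erefl)[] xC; [left|right] => _ ->.
Qed.

(** A finite irreducible set in a T1 space is a single point: for [x] in [A], both [[set x]] and its
    complement in [A] are finite, hence closed, and the second misses [x]. This limits the length of
    irreducible chains. *)
Lemma finite_irreducible_subset (A B : set T) : accessible_space T ->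
  finite_set A -> irreducible A -> B !=set0 -> B `<=` A -> A `<=` B.
Proof.
move=> T1 finA [_ irrA] [x Bx] BA.
have cl : forall S : set T, finite_set S -> closed S.
  exact/accessible_finite_set_closed.
have AxA : A `<=` [set x] `|` A `\ x.
  by move=> y Ay; have [->|yx] := pselect (y = x); [left|right].
have clx : closed [set x] by apply: cl; exact: finite_set1.
have clA : closed (A `\ x) by apply: cl; exact: finite_setD.
have [Ax|AAx] := irrA _ _ clx clA AxA; first by move=> y /Ax ->.
by have [_ /(_ erefl)] := AAx _ (BA _ Bx).
Qed.

End Irreducible.

(** * The Zariski topology and the orbits on the line [nilrad k 2] *)

Section Line.
Variable k : closedFieldType.
Implicit Types (x y : nilrad k 2) (C : set (nilrad k 2)).

Lemma nilrad2E x : x = X k x *: x_alpha k.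
Proof.
apply/val_inj/matrixP => i j /=.
have /strict_upperP ux := valP x.
rewrite !mxE; case: (ltnP i j) => [ij|ji]; last first.
  rewrite ux//; case: andP => [[/eqP iE /eqP jE]|_]; last by rewrite mulr0.
  by move: ji; rewrite iE jE.
have iE : i = 0 by apply/val_inj; case: i j ij => [[|[|?]]//= ?] [[|[|?]]//=].
have jE : j = 1 by apply/val_inj; case: i j ij {iE} => [[|[|?]]//= ?] [[|[|?]]//=].
by rewrite iE jE !eqxx mulr1.
Qed.

Lemma X_inj : injective (X k).
Proof. by move=> x y xy; rewrite (nilrad2E x) xy -nilrad2E. Qed.

Lemma polynomial_fun_horner (f : nilrad k 2 -> k) :
  polynomial_fun f -> exists q : {poly k}, forall x, f x = q.[X k x].
Proof.
move=> [p fE].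
suff [q qE] : exists q : {poly k}, forall z,
    meval (fun i => mxvec (z *: x_alpha k : nilrad k 2) 0 i) p = q.[z].
  by exists q => x; rewrite fE -qE -nilrad2E.
elim/mpolyind: p {f fE} => [|c m p _ _ [q qE]].
  by exists 0 => z; rewrite meval0 horner0.
(* At [z *: x_alpha k] each matrix entry is a constant times [z], so every variable of the monomial
   [m] is replaced by that constant times ['X]. *)
exists (c *: \prod_i (mxvec (x_alpha k) 0 i *: 'X) ^+ m i + q) => z.
rewrite mevalD mevalZ qE !hornerE mevalX horner_prod.
congr (_ * _ + _); apply: eq_bigr => i _.
by rewrite !hornerE linearZ/= mxE mulrC.
Qed.

(** A proper closed set is killed by some nonzero polynomial in [X]; this has finitely many roots,
    and [X] is injective. *)
Lemma closed_nilrad2 C : closed C -> C <> setT -> finite_set C.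
Proof.
rewrite closed_zariskiE => -[F polF ->] FT.
have [f Ff [y fy]] : exists2 f, F f & exists y, f y <> 0.
  apply: contrapT => h; apply: FT; apply/seteqP; split=> // x _ f Ff.
  by apply: contrapT => fx; apply: h; exists f => //; exists x.
have [q qE] := polynomial_fun_horner (polF _ Ff).
have q0 : q != 0 by apply/eqP => q0; apply: fy; rewrite qE q0 horner0.
have [s sE] := closed_field_poly_normal q.
suff : finite_set (X k @^-1` [set` s]).
  apply: sub_finite_set => x /(_ _ Ff) /eqP; rewrite qE -rootE sE.
  by rewrite rootZ ?lead_coef_eq0// root_prod_XsubC.
apply: finite_preimage; last exact: finite_seq.
by move=> x y' _ _; exact: X_inj.
Qed.

Lemma closed_nilrad2_set1 x : closed [set x].
Proof.
rewrite closed_zariskiE; exists [set fun y => X k y - X k x].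
  move=> _ ->; have [p pE] := X_polynomial k.
  by exists (p - mpolyC _ (X k x)) => y; rewrite mevalB mevalC pE.
apply/seteqP; split=> [_ -> _ ->|y /(_ _ erefl)/eqP]; first exact: subrr.
by rewrite subr_eq0 => /eqP/X_inj.
Qed.

Lemma accessible_nilrad2 : accessible_space (nilrad k 2).
Proof.
move=> x y /eqP xy; exists (~` [set y]).
by rewrite openC !inE /=; split; [exact: closed_nilrad2_set1|..|move=> /(_ erefl)].
Qed.

Lemma infinite_closure_nilrad2 C : infinite_set C -> closure C = setT.
Proof.
move=> infC; apply: contrapT => /(closed_nilrad2 (@closed_closure _ C)).
by move=> /(sub_finite_set (@subset_closure _ C)).
Qed.

(** Two proper closed sets are finite, so together they cannot cover an infinite set. *)
Lemma infinite_irreducible_nilrad2 C : infinite_set C -> irreducible C.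
Proof.
move=> infC; split.
  by apply/set0P/eqP => C0; apply: infC; rewrite C0; exact: finite_set0.
move=> D E clD clE CDE.
have [->|DT] := pselect (D = setT); first by left.
have [->|ET] := pselect (E = setT); first by right.
exfalso; apply: infC; apply: sub_finite_set CDE _.
by rewrite finite_setU; split; apply: closed_nilrad2.
Qed.

Lemma has_dim1_nilrad2 C : infinite_set C -> has_dim C 1.
Proof.
move=> infC; have irrC := infinite_irreducible_nilrad2 infC.
have [[x Cx] _] := irrC.
have cl1 := @closed_nilrad2_set1 x.
split.
  exists (fun i => if i is 0%N then [set x] else C); split.
    move=> [|i] _; split => //; [|exact: irreducible1|].
    + exists [set x] => //; apply/seteqP; split=> y; last by case.
      by move=> ->.
    + by exists setT; [exact: closedT|rewrite setIT].
  move=> [|//] _; split=> [|Cx1]; first by move=> _ ->.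
  by apply: infC; apply: sub_finite_set Cx1 _; exact: finite_set1.
(* In a chain with [c 0 < c 1 < c 2], the closed set [D] cutting out [c 1] is proper, since
   otherwise [c 1 = C] would contain [c 2]. So [c 1] is finite and irreducible, hence a point, which
   leaves no room for a smaller nonempty [c 0]. *)
move=> [|[|m]] // c [cirr clt]; exfalso.
have [[c01 nc01] [c12 nc12]] := (clt 0%N isT, clt 1%N isT).
have [_ [c0 _]] := cirr 0%N isT.
have [[D clD c1E] irr1] := cirr 1%N isT.
have [[E clE c2E] _] := cirr 2%N isT.
apply: nc01; apply: finite_irreducible_subset => //.
  exact: accessible_nilrad2.
apply: (@sub_finite_set _ _ D); first by rewrite c1E => ? [].
apply: closed_nilrad2 => // DT; apply: nc12.
by rewrite c1E c2E DT => y [].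
Qed.

Lemma X0 : X k 0 = 0.
Proof. by rewrite /X mxE. Qed.

Lemma Z_X : Z [:: X k] = [set 0].
Proof.
apply/seteqP; split=> [x|_ ->]; rewrite /Z/= andbT; last by rewrite X0.
by rewrite -X0 => /eqP/X_inj.
Qed.

Lemma infinite_V_X : infinite_set (V [:: X k]).
Proof.
move=> finV; apply: (@closed_field_infinite k).
(* Once the origin is added, [X] maps this set onto the infinite field [k]. *)
have : finite_set (X k @` (V [:: X k] `|` [set 0])).
  by apply: finite_image; rewrite finite_setU; split=> //; exact: finite_set1.
apply: sub_finite_set => z _.
exists (z *: x_alpha k); last exact: X_x_alpha.
have [->|z0] := eqVneq z 0; [by right; rewrite scale0r|left].
by rewrite /V/= X_x_alpha z0.
Qed.

Lemma has_dim0_set1 x : has_dim [set x] 0.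
Proof.
have cl1 := @closed_nilrad2_set1 x.
split.
  exists (fun=> [set x]); split=> // i _; split; last exact: irreducible1.
  by exists [set x]; rewrite ?setIid.
(* The nonempty [c 0] already equals [[set x]], so [c 1] cannot be strictly larger. *)
move=> [|m] // c [cirr clt]; exfalso.
have [c01 nc01] := clt 0%N isT; apply: nc01.
have [[D _ ->] _] := cirr 1%N isT; have [[E _ c0E] [[y c0y] _]] := cirr 0%N isT.
by move=> _ [-> _]; move: (c0y); rewrite {1}c0E => -[<-].
Qed.

Lemma X_Ad (b : borel k 2) x : X k (Ad b x) = b 0 0 ^+ 2 * X k x.
Proof.
have /upper_triangularP ub := bmx_upper b.
have /strict_upperP ux := valP x.
have /strict_upperP uy := valP (Ad b x).
have bb : b 0 0 * b 1 1 = 1.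
  (* The transpose is taken because [det_trig] expects a lower triangular matrix. *)
  rewrite -(bmx_det b) -det_tr det_trig ?big_ord_recl ?big_ord0 ?mxE ?mulr1.
    by congr (_ * b _ _); exact/val_inj.
  by apply/is_trig_mxP => i j ij; rewrite mxE ub.
(* Comparing upper right entries, without computing [invmx b], gives
   [X k (Ad b x) * b 1 1 = b 0 0 * X k x]; multiplying by [b 0 0] and using [bb] then isolates
   [X k (Ad b x)]. *)
have /matrixP/(_ 0 1) : Ad b x *m b = b *m x by rewrite /= mulmxKV// bmx_unit.
rewrite !mxE !big_ord_recr !big_ord0/= !add0r.
have -> : widen_ord (leqnSn 1) ord_max = 0 :> 'I_2 by exact/val_inj.
have -> : ord_max = 1 :> 'I_2 by exact/val_inj.
rewrite uy// [x 1 1]ux// mul0r add0r mulr0 addr0 => h.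
have := congr1 ( *%R (b 0 0)) h.
by rewrite mulrCA bb mulr1 mulrA -expr2.
Qed.

Lemma B_orbitE x : B_orbit x = [set y | (X k y == 0) = (X k x == 0)].
Proof.
apply/seteqP; split=> [_ [b _ <-]|y] /=.
  by rewrite X_Ad mulf_eq0 sqrf_eq0 (negPf (bmx_diag _ _)).
move=> yx.
(* By [X_Ad], moving [x] to [y] requires a diagonal entry [a] with this property: a square root of
   the ratio of coordinates, or [1] when both vanish. *)
have [a a0 ayx] : exists2 a, a != 0 & X k y = a ^+ 2 * X k x.
  have [x0|x0] := eqVneq (X k x) 0.
    by exists 1; rewrite ?oner_neq0// x0 mulr0; apply/eqP; rewrite yx x0.
  have [a aE] := closed_field_sqrt (X k y / X k x).
  exists a; last by rewrite aE divfK.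
  by rewrite -sqrf_eq0 aE mulf_neq0 ?invr_eq0// yx.
pose d : 'rV[k]_2 := \row_j if j == 0 then a else a^-1.
have dd : \det (diag_mx d) = 1.
  by rewrite det_diag !big_ord_recr big_ord0/= !mxE/= mul1r divff.
have du : upper_triangular (diag_mx d).
  apply/upper_triangularP => i j ji; rewrite mxE.
  by case: eqP ji => [->|]; rewrite ?ltnn ?mulr0n.
exists (Borel dd du) => //; apply: X_inj.
by rewrite X_Ad ayx /= !mxE.
Qed.

End Line.

Theorem proposition3 (k : closedFieldType) :
  let O0 : set (nilrad k 2) := B_orbit 0 in
  let O1 : set (nilrad k 2) := B_orbit (x_alpha k) in
  [/\ B_orbits k 2 = [set O0; O1] /\ O0 <> O1,
      modality0 k 2,
      [/\ O0 = Z [:: X k], closure O0 = Z [:: X k] & has_dim O0 0%N],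
      [/\ O1 = V [:: X k], closure O1 = setT & has_dim O1 1%N] &
      forall O O', B_orbits k 2 O -> B_orbits k 2 O' ->
        (orbit_lt O O' <-> O = O0 /\ O' = O1)].
Proof.
move=> O0 O1.
have Xa : X k (x_alpha k) = 1 by rewrite -[x_alpha k]scale1r X_x_alpha.
have O0E : O0 = Z [:: X k].
  by rewrite /O0 B_orbitE X0 eqxx /Z; apply/seteqP; split=> x /=; rewrite andbT.
have O1E : O1 = V [:: X k].
  rewrite /O1 B_orbitE Xa oner_eq0 /V.
  by apply/seteqP; split=> x /=; rewrite andbT; case: (X k x == 0).
have neq : O0 <> O1.
  move=> h; have : O1 0 by rewrite -h O0E Z_X.
  by rewrite O1E /V/= X0 eqxx.
have orbE : B_orbits k 2 = [set O0; O1].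
  apply/seteqP; split=> [_ [x _ <-]|_ [->|->]]; last 2 first.
  - by exists 0.
  - by exists (x_alpha k).
  have [x0|x0] := eqVneq (X k x) 0; [left|right].
    by rewrite /O0 !B_orbitE x0 X0.
  by rewrite /O1 !B_orbitE Xa oner_eq0 (negPf x0).
have cl0 : closure O0 = Z [:: X k].
  by rewrite O0E Z_X; apply/esym/closure_id/closed_nilrad2_set1.
have cl1 : closure O1 = setT.
  by rewrite O1E; apply/infinite_closure_nilrad2/infinite_V_X.
split => //.
- by rewrite /modality0 orbE; exact: finite_set2.
- by split=> //; rewrite O0E Z_X; exact: has_dim0_set1.
- by split=> //; rewrite O1E; apply/has_dim1_nilrad2/infinite_V_X.
rewrite orbE => O O' OO OO'; split=> [|[-> ->]]; last first.
  by split=> //; rewrite /orbit_le cl1.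
case: OO OO' => -> [->|->] [le neqO] //.
(* Only [O = O1], [O' = O0] is left; it would put the infinite set [O1] inside the single point
   [closure O0]. *)
exfalso; apply: (@infinite_V_X k); rewrite -O1E.
by move: le; rewrite /orbit_le cl0 Z_X => /sub_finite_set; apply; exact: finite_set1.
Qed.
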